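(* Let $\phi:\mathbb{R}^d\to\mathbb{R}$ be any positive, bounded, continuous function for which there exists some $x_0\in\mathbb{R}^d$ such that $\phi(x_0+y)=\phi(x_0-y)$ for all $y\in\mathbb{R}^d$. Assume moreover that $\phi(x_0+z)<\phi(x_0)$ for some $z\in\mathbb{R}^d$. Define $$G(x,m)=\phi(x)\,\sigma_T(m),\qquad \sigma_T(m)=\int_{\mathbb{R}^d}\phi\,dm,\qquad L(x,v)=\tfrac12|v|^2.$$ Then the Lasry–Lions monotonicity condition (LL) is satisfied strongly by $G$, but uniqueness of the mean field game equilibria does not hold for the initial measure $m_0=\delta_{x_0}$: there exists a time horizon $T>0$ for which there are at least two distinct equilibria with initial measure $\delta_{x_0}$.
   Context: $\mathscr{P}_2(\mathbb{R}^d)$ is the set of Borel probability measures on $\mathbb{R}^d$ with finite second moment. (LL) for $G$: $\int_{\mathbb{R}^d}(G(x,m_1)-G(x,m_2))\,d(m_1-m_2)(x)\ge0$ for all $m_1,m_2\in\mathscr{P}_2(\mathbb{R}^d)$. It holds strongly if in addition equality implies that $G(\cdot,m_1)$ and $G(\cdot,m_2)$ are identical. Equilibria: for $T>0$ let $\Gamma=\mathrm{AC}(0,T;\mathbb{R}^d)$ be the space of absolutely continuous curves on $[0,T]$ (with the topology of uniform convergence), $e_t(\gamma)=\gamma(t)$, $\Gamma[x]=\{\gamma\in\Gamma:\gamma(0)=x\}$. For $m_0\in\mathscr{P}_2(\mathbb{R}^d)$, $\mathscr{P}_{m_0}(\Gamma)$ is the set of Borel probability measures $\eta$ on $\Gamma$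 with $(e_0)_\sharp\eta=m_0$, with disintegration $\eta(d\gamma)=\int\eta_x(d\gamma)\,dm_0(x)$, $\eta_x$ supported in $\Gamma[x]$. Put $J^\eta[\gamma]=\int_0^TL(\gamma_s,\dot\gamma_s)\,ds+G(\gamma_T,(e_T)_\sharp\eta)$ and let $\Gamma^\eta[x]$ be the set of minimizers of $J^\eta$ over $\Gamma[x]$. An equilibrium for $m_0$ is an $\eta\in\mathscr{P}_{m_0}(\Gamma)$ such that $\mathrm{spt}(\eta_x)\subseteq\Gamma^\eta[x]$ for $m_0$-a.e. $x$. *)

(* Defs.v *)
From HB Require Import structures.
From mathcomp Require Import all_boot all_order all_algebra.
From mathcomp Require Import all_classical all_reals all_analysis.

Set Implicit Arguments.
Unset Strict Implicit.
Unset Printing Implicit Defensive.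

Import Order.TTheory GRing.Theory Num.Theory.
Import numFieldNormedType.Exports.

Local Open Scope classical_set_scope.
Local Open Scope ring_scope.

(* Borel sigma-algebra on matrices, hence on R^d = 'rV[R]_d *)
HB.instance Definition _ (R : realType) (m n : nat) :=
  Measurable.copy 'M[R]_(m, n) (g_sigma_algebraType (@open 'M[R]_(m, n))).

(* Euclidean norm: the notation `|v| on 'rV[R]_d is the max norm. *)
Definition norm2 (R : realType) (d : nat) (v : 'rV[R]_d) : R :=
  Num.sqrt (\sum_(i < d) v ord0 i ^+ 2).

Definition P2 (R : realType) (d : nat) : set (probability 'rV[R]_d R) :=
  [set m | (\int[m]_x (norm2 x ^+ 2)%:E < +oo)%E].
Arguments P2 : clear implicits.

(* Integral of f against the signed measure m1 - m2 *)
Definition integral_diff (R : realType) (d : nat)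
    (m1 m2 : probability 'rV[R]_d R) (f : 'rV[R]_d -> R) : \bar R :=
  (\int[m1]_x (f x)%:E - \int[m2]_x (f x)%:E)%E.

Definition lasry_lions (R : realType) (d : nat)
    (G : 'rV[R]_d -> probability 'rV[R]_d R -> R) : Prop :=
  forall m1 m2, P2 R d m1 -> P2 R d m2 ->
    (0 <= integral_diff m1 m2 (fun x => (G x m1 - G x m2)%R))%E.

Definition strong_lasry_lions (R : realType) (d : nat)
    (G : 'rV[R]_d -> probability 'rV[R]_d R -> R) : Prop :=
  lasry_lions G /\
  forall m1 m2, P2 R d m1 -> P2 R d m2 ->
    integral_diff m1 m2 (fun x => G x m1 - G x m2) = 0%E ->
    forall x, G x m1 = G x m2.

Definition abs_continuous (R : realType) (d : nat) (T : R)
    (g : R -> 'rV[R]_d) : Prop :=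
  forall e : R, 0 < e -> exists2 r : R, 0 < r &
    forall (n : nat) (a b : 'I_n -> R),
      (forall i, 0 <= a i /\ a i < b i /\ b i <= T) ->
      trivIset [set: 'I_n] (fun i => `]a i, b i[%classic) ->
      \sum_(i < n) (b i - a i) < r ->
      \sum_(i < n) norm2 (g (b i) - g (a i)) < e.

(* A curve on [0, T] is represented by its extension by 0 to the whole line,
   so that two representatives are equal iff the curves agree on [0, T]. *)
Definition AC (R : realType) (d : nat) (T : R) :
    set {uniform` `[0, T]%classic -> 'rV[R]_d} :=
  [set g | abs_continuous T g /\ forall t, t \notin `[0, T] -> g t = 0].
Arguments AC : clear implicits.

Lemma AC0 (R : realType) (d : nat) (T : R) : (fun=> 0) \in AC R d T.
Proof.
rewrite inE; split=> // e e0; exists 1 => // n a b _ _ _.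
rewrite big1// => i _; rewrite subrr /norm2 big1 ?sqrtr0// => j _.
by rewrite mxE expr0n.
Qed.

(* set_type carries the topology induced by uniform convergence on [0, T]. *)
Definition curve (R : realType) (d : nat) (T : R) : Type :=
  set_type (AC R d T).
Arguments curve : clear implicits.

HB.instance Definition _ (R : realType) (d : nat) (T : R) :=
  Topological.copy (curve R d T) (set_type (AC R d T)).
HB.instance Definition _ (R : realType) (d : nat) (T : R) :=
  isPointed.Build (curve R d T)
    (exist (fun g => g \in AC R d T) (fun=> 0) (AC0 d T)).
HB.instance Definition _ (R : realType) (d : nat) (T : R) :=
  Measurable.copy (curve R d T) (g_sigma_algebraType (@open (curve R d T))).

Definition curve_fun (R : realType) (d : nat) (T : R) (g : curve R d T) :
  R -> 'rV[R]_d := \val g.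
Coercion curve_fun : curve >-> Funclass.

Definition ev (R : realType) (d : nat) (T t : R) (g : curve R d T) :
  'rV[R]_d := g t.
Arguments ev {R d T} t g.

Lemma continuous_ev (R : realType) (d : nat) (T t : R) :
  t \in `[0, T] -> continuous (@ev R d T t).
Proof.
move=> t0T g.
have FF : Filter (nbhs g) by exact: nbhs_filter.
apply/cvg_entourageP => A entA.
have nA : nbhs (set_val g : {uniform` `[0, T]%classic -> 'rV[R]_d})
    [set h | forall s, `[0, T]%classic s -> A (ev s g, h s)].
  by apply: (uniform_nbhs _ _).2; exists A; split => // h; exact.
have nB := @initial_continuous (curve R d T) _ set_val g _ nA.
apply: (@filterS _ _ FF _ _ _ nB) => h /=; exact.
Qed.

Lemma measurable_ev (R : realType) (d : nat) (T t : R) :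
  measurable_fun setT (@ev R d T t).
Proof.
have [t0T|t0T] := boolP (t \in `[0, T]); last first.
  rewrite (_ : ev t = cst 0); first exact: measurable_cst.
  by apply/funext => -[g gP]; have [_ g0] := set_mem gP; exact: g0.
apply: (@measurability _ _ _ _ _ _ (@open 'rV[R]_d)) => //.
move=> _ [B oB <-]; rewrite setTI; apply: sub_sigma_algebra.
exact: (continuousP _).1 (continuous_ev t0T) B oB.
Qed.

HB.instance Definition _ (R : realType) (d : nat) (T t : R) :=
  isMeasurableFun.Build _ _ _ _ (@ev R d T t) (@measurable_ev R d T t).

Definition support (R : realType) (X : ptopologicalType)
    (mu : set X -> \bar R) : set X :=
  [set x | forall U : set X, open U -> U x -> (0 < mu U)%E].

Section mean_field_game.
Context {R : realType} {d : nat} {T : R}.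
Variables (L : 'rV[R]_d -> 'rV[R]_d -> R).
Variables (G : 'rV[R]_d -> probability 'rV[R]_d R -> R).
Implicit Types (eta : probability (curve R d T) R).

(* derive1 g is meaningful at almost every s, by absolute continuity. *)
Definition cost eta (g : curve R d T) : \bar R :=
  (\int[lebesgue_measure]_(s in `[0%R, T]) (L (g s) (derive1 g s))%:E
   + (G (g T) (distribution eta (ev T)))%:E)%E.

Definition curves_from (x : 'rV[R]_d) : set (curve R d T) :=
  [set g | g 0 = x].

Definition minimizers eta (x : 'rV[R]_d) : set (curve R d T) :=
  [set g | curves_from x g /\
    forall h, curves_from x h -> (cost eta g <= cost eta h)%E].

Definition initial_law (m0 : probability 'rV[R]_d R) :
    set (probability (curve R d T) R) :=
  [set eta | forall B, measurable B -> distribution eta (ev 0) B = m0 B].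

Definition disintegration (m0 : probability 'rV[R]_d R) eta
    (k : R.-pker 'rV[R]_d ~> curve R d T) : Prop :=
  (forall A, measurable A -> eta A = \int[m0]_x k x A)%E /\
  {ae m0, forall x, support (k x) `<=` curves_from x}.

(* The disintegration of eta is unique up to an m0-null set, so the choice of
   the kernel k is immaterial. *)
Definition equilibrium (m0 : probability 'rV[R]_d R) eta : Prop :=
  initial_law m0 eta /\
  exists2 k : R.-pker 'rV[R]_d ~> curve R d T, disintegration m0 eta k &
    {ae m0, forall x, support (k x) `<=` minimizers eta x}.

End mean_field_game.

(* Main.v *)
From HB Require Import structures.
Require Import Defs.
From mathcomp Require Import all_boot all_order all_algebra.
From mathcomp Require Import all_classical all_reals all_analysis.
From mathcomp Require Import measurable_realfun ring lra.

Set Implicit Arguments.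
Unset Strict Implicit.
Unset Printing Implicit Defensive.

Import Order.TTheory GRing.Theory Num.Theory.
Import numFieldNormedType.Exports.

Local Open Scope classical_set_scope.
Local Open Scope ring_scope.

(** The running cost is quadratic, so by Jensen's inequality the cheapest way
    to reach [y] at time [T] from [x] is the straight line, at price
    [|y - x|^2 / (2T)]. Against a population whose terminal law has
    [sigmaT = S], an agent starting at [x] therefore picks [y] minimizing the
    reduced cost [F_S y = |y - x|^2 / (2T) + S * phi y]. An equilibrium from
    [\d_x] is then a law on straight lines that end at minimizers of [F_S] and
    give back [S] as the mean of [phi].

    A fixed point exists. The values [S] for which some minimizer has
    [S <= phi y], and those for which some minimizer has [phi y <= S], form two
    closed sets that cover a segment; the segment being connected, they meet at
    some [S], which is then a convex combination [a * phi y1 + (1 - a) * phi y2]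
    of values at two minimizers ([reduced_fixed_point]). The equilibrium is
    carried by at most two straight lines ([equilibrium_of_fixed_point]).

    It is not unique. Once [T] is so large that travelling to the point where
    [phi] is smaller costs less than what it saves, staying at [x] forever is no
    longer a fixed point, so that one of the lines really moves
    ([moving_fixed_point]). The symmetry of [phi] about [x] makes the reflected
    line another minimizer with the same terminal value of [phi]
    ([reduced_minimizer_reflect]); reflecting that line only gives a second
    equilibrium. Monotonicity is immediate: the Lasry-Lions integral is
    [(sigmaT m1 - sigmaT m2)^2] ([integral_diff_product]).

    Most of the work is the lower bound on the energy of an arbitrary
    absolutely continuous competitor ([kinetic_energy_ge]), which rests on the
    fundamental theorem of calculus for absolutely continuous functions
    ([ac_derivable]). An absolutely continuous [f] is written [V - (V - f)] with
    [V] its total variation, both terms being nondecreasing and absolutely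
    continuous ([ac_total_variation]); the Lebesgue-Stieltjes measure of such a
    function does not charge Lebesgue-null sets ([ac_cumulative_null]), hence
    has a Radon-Nikodym density ([nondecreasing_ac_density]), and Lebesgue's
    differentiation theorem identifies this density with the derivative. *)

(** * Absolute continuity on families of intervals *)

Definition apart (R : realType) (x y : R * R) :=
  (x.2 <= y.1) || (y.2 <= x.1).

Definition itv_family (R : realType) (T : R) (s : seq (R * R)) :=
  all (fun x => [&& 0 <= x.1, x.1 < x.2 & x.2 <= T]) s &&
  pairwise (@apart R) s.

(** Families are lists, in contrast with the ordinal-indexed ones of
    [abs_continuous], because the argument on total variations concatenates
    them. *)
Definition ac_fun (R : realType) (T : R) (f : R -> R) :=
  forall e : R, 0 < e -> exists2 r : R, 0 < r &
    forall s, itv_family T s -> \sum_(x <- s) (x.2 - x.1) < r ->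
      \sum_(x <- s) `|f x.2 - f x.1| <= e.

Section absolute_continuity.
Context {R : realType}.
Implicit Types (T : R) (f g : R -> R) (s t : seq (R * R)).

Lemma abs_continuous_lipschitz d T (g : R -> 'rV[R]_d) (f : R -> R) (C : R) :
  abs_continuous T g ->
  (forall a b, `|f b - f a| <= C * norm2 (g b - g a)) -> ac_fun T f.
Proof.
move=> acg fg e e0; pose K := Num.max C 1.
have K0 : 0 < K by rewrite lt_max ltr01 orbT.
have [r r0 gr] := acg (e / K) (divr_gt0 e0 K0); exists r => // s.
move=> /andP[/all_nthP sT /pairwiseP sepP] sr.
rewrite (big_nth (0, 0)) big_mkord.
have := gr (size s) (fun k => (nth (0, 0) s k).1) (fun k => (nth (0, 0) s k).2).
move=> /(_ _ _ _)/ltW; rewrite ler_pdivlMr// mulrC mulr_sumr => H.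
apply: le_trans (H _ _ _).
- apply: ler_sum => k _; rewrite (le_trans (fg _ _))// ler_wpM2r ?sqrtr_ge0//.
  by rewrite le_max lexx.
- by move=> k; have /and3P[? ? ?] := sT (0, 0) k (ltn_ord k).
- apply/trivIsetP => j k _ _ jk; apply/seteqP; split => // x /=.
  rewrite !in_itv/= => -[/andP[jx xj] /andP[kx xk]].
  wlog jltk : j k jk jx xj kx xk / (j < k)%N.
    move=> H'; have := jk; rewrite -val_eqE neq_ltn => /orP[|] ?.
      exact: (H' j k).
    by apply: (H' k j) => //; rewrite eq_sym.
  have := sepP (0, 0) j k; rewrite !inE !ltn_ord => /(_ isT isT jltk).
  move=> /orP[|] h.
    by have := lt_trans (lt_le_trans xj h) kx; rewrite ltxx.
  by have := lt_trans (lt_le_trans xk h) jx; rewrite ltxx.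
- by rewrite (big_nth (0, 0)) big_mkord in sr.
Qed.

Lemma ac_funB T f g : ac_fun T f -> ac_fun T g -> ac_fun T (f \- g).
Proof.
move=> acf acg e e0; have e20 : 0 < e / 2 by rewrite divr_gt0.
have [r r0 fr] := acf _ e20; have [r' r'0 gr] := acg _ e20.
exists (Num.min r r'); first by rewrite lt_min r0.
move=> s sT; rewrite lt_min => /andP[sr sr'].
rewrite [leRHS](splitr e) (le_trans _ (lerD (fr _ sT sr) (gr _ sT sr')))//.
rewrite -big_split/=; apply: ler_sum => x _.
have -> : (f \- g) x.2 - (f \- g) x.1 = (f x.2 - f x.1) - (g x.2 - g x.1).
  by rewrite /=; ring.
exact: ler_normB.
Qed.

Definition partition_cells (a : R) (p : seq R) : seq (R * R) :=
  pairmap pair a p.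

Lemma variation_cells a b f p :
  variation a b f p = \sum_(x <- partition_cells a p) `|f x.2 - f x.1|.
Proof.
rewrite /variation (big_nth (b, b)) size_pairmap; apply: eq_big_nat => k /=.
by move=> kp; rewrite (nth_pairmap b).
Qed.

Lemma sum_cells a b p : itv_partition a b p ->
  \sum_(x <- partition_cells a p) (x.2 - x.1) = b - a.
Proof.
elim: p a => [|c p IH] a abp /=.
  by rewrite big_nil (itv_partition_nil abp) subrr.
by rewrite big_cons/= (IH _ (itv_partition_cons abp)); ring.
Qed.

Lemma cells_sub a b p : itv_partition a b p ->
  all (fun x => [&& a <= x.1, x.1 < x.2 & x.2 <= b]) (partition_cells a p).
Proof.
elim: p a => [//|c p IH] a abp /=.
have cbp := itv_partition_cons abp.
have ac : a < c by case: abp => /= /andP[].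
rewrite lexx ac (itv_partition_le cbp)/=.
apply: sub_all (IH _ cbp) => x /and3P[cx -> ->]; rewrite !andbT.
exact: le_trans (ltW ac) cx.
Qed.

Lemma cells_apart a b p : itv_partition a b p ->
  pairwise (@apart R) (partition_cells a p).
Proof.
elim: p a => [//|c p IH] a abp /=.
have cbp := itv_partition_cons abp.
rewrite IH// andbT; apply: sub_all (cells_sub cbp) => x /and3P[cx _ _].
by rewrite /apart cx.
Qed.

(** Cutting one interval of a family along a partition keeps the total length,
    so the modulus of absolute continuity still applies to the result. *)
Lemma itv_family_refine T a b p s : itv_partition a b p ->
  itv_family T ((a, b) :: s) -> itv_family T (partition_cells a p ++ s).
Proof.
move=> abp /andP[/= /andP[/and3P[a0 ab bT] sT] /andP[abs sep]].
apply/andP; split.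
  rewrite all_cat sT andbT.
  apply: sub_all (cells_sub abp) => x /and3P[ax -> xb].
  by rewrite (le_trans a0 ax) (le_trans xb bT).
rewrite pairwise_cat sep (cells_apart abp) !andbT allrelC.
apply/allP => y ys; apply: sub_all (cells_sub abp) => x /and3P[ax _ xb].
have /allP/(_ _ ys)/orP[/= h|/= h] := abs; rewrite /apart.
  by rewrite (le_trans xb h).
by rewrite (le_trans h ax) orbT.
Qed.

Lemma apart_sym : symmetric (@apart R).
Proof. by move=> x y; rewrite /apart orbC. Qed.

Lemma itv_family_catCA T s1 s2 t :
  itv_family T (s1 ++ s2 ++ t) = itv_family T (s2 ++ s1 ++ t).
Proof.
have sepC : allrel (@apart R) s1 s2 = allrel (@apart R) s2 s1.
  by rewrite allrelC; apply: eq_allrel => x y; exact: apart_sym.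
rewrite /itv_family !all_cat !pairwise_cat !allrel_catr sepC.
case: (allrel _ s2 s1); case: (allrel _ s1 t); case: (allrel _ s2 t);
  case: (pairwise _ s1); case: (pairwise _ s2);
  by rewrite ?andbF//= andbCA.
Qed.

Lemma itv_family_cons T x s : itv_family T (x :: s) -> itv_family T s.
Proof. by move=> /andP[/= /andP[_ sT] /andP[_ ss]]; apply/andP. Qed.

(** Each total variation is a supremum over partitions, and a partition of one
    interval merely refines the family; intervals are replaced one at a time,
    those in [t] below being already cut. *)
Lemma sum_total_variation_le T f e r :
  (forall s, itv_family T s -> \sum_(x <- s) (x.2 - x.1) < r ->
      \sum_(x <- s) `|f x.2 - f x.1| <= e) ->
  forall s, itv_family T s -> \sum_(x <- s) (x.2 - x.1) < r ->
  (\sum_(x <- s) total_variation x.1 x.2 f <= e%:E)%E.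
Proof.
move=> fr s sT sr.
suff H : forall s t, itv_family T (s ++ t) ->
    \sum_(x <- s ++ t) (x.2 - x.1) < r ->
    (\sum_(x <- s) total_variation x.1 x.2 f +
      (\sum_(x <- t) `|f x.2 - f x.1|)%:E <= e%:E)%E.
  by have := H s [::]; rewrite cats0 big_nil adde0; exact.
move=> {s sT sr}; elim=> [|[a b] s IH] t stT str.
  by rewrite big_nil add0e lee_fin fr.
have ab : a < b by case/andP: stT => /= /andP[/and3P[]].
have stT' : itv_family T (s ++ t) := itv_family_cons stT.
have str' : \sum_(x <- s ++ t) (x.2 - x.1) < r.
  rewrite /= big_cons/= in str.
  by apply: le_lt_trans str; rewrite lerDr subr_ge0 ltW.
set S := (\sum_(x <- s) total_variation x.1 x.2 f)%E.
set u := \sum_(x <- t) `|f x.2 - f x.1|.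
have Sfin : S \is a fin_num.
  rewrite ge0_fin_numE; last first.
    rewrite /S big_seq sume_ge0// => x xs.
    case/andP: stT' => + _; rewrite all_cat => /andP[/allP/(_ _ xs) + _].
    by move=> /and3P[_ /ltW x12 _]; exact: total_variation_ge0.
  apply: le_lt_trans (ltry e); apply: le_trans (IH t stT' str').
  by rewrite leeDl// lee_fin sumr_ge0.
rewrite big_cons/= -/S -addeA -leeBrDr ?fin_numD ?Sfin//.
apply: ge_ereal_sup => _ [_ [p abp <-] <-].
rewrite leeBrDr ?fin_numD ?Sfin// variation_cells addeCA -EFinD -big_cat/=.
have perm : perm_eq (s ++ partition_cells a p ++ t)
    (partition_cells a p ++ s ++ t).
  by rewrite perm_catCA.
apply: IH; last first.
  rewrite (perm_big _ perm) big_cat/= (sum_cells abp).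
  by rewrite /= big_cons in str.
rewrite itv_family_catCA.
exact: itv_family_refine abp stT.
Qed.

End absolute_continuity.

(** * Total variation and Lebesgue-Stieltjes measure *)

Section absolutely_continuous_density.
Context {R : realType}.
Implicit Types (T : R) (f g : R -> R) (s : seq (R * R)).
Local Notation mu := (@lebesgue_measure R).

(** If [r] is the modulus of absolute continuity associated with [1], then the
    variation over an interval shorter than [r] is at most [1], and $[0, t]$ is
    a union of finitely many intervals of length at most [r / 2]. *)
Lemma ac_total_variation_fin_num T f t : ac_fun T f -> 0 <= t -> t <= T ->
  total_variation 0 t f \is a fin_num.
Proof.
move=> acf t0 tT; have [r r0 fr] := acf 1 ltr01.
suff H n : t <= n%:R * (r / 2) -> (total_variation 0 t f <= n%:R%:E)%E.
  rewrite ge0_fin_numE ?total_variation_ge0//.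
  apply: le_lt_trans (ltry (Num.bound (t / (r / 2)))%:R).
  apply: H; rewrite -ler_pdivrMr ?divr_gt0//.
  by rewrite ltW// archi_boundP// divr_ge0// divr_ge0// ltW.
elim: n t t0 tT => [|n IH] t t0 tT tn.
  have -> : t = 0 by apply/eqP; rewrite eq_le t0 -(mul0r (r / 2)) tn.
  by rewrite total_variationxx.
(* the left end of the last piece, shorter than [r / 2] if it would cross [0] *)
pose c := Num.max 0 (t - r / 2).
have c0 : 0 <= c by rewrite le_max lexx.
have ct : c <= t by rewrite ge_max t0 gerBl divr_ge0// ltW.
have cn : c <= n%:R * (r / 2).
  rewrite ge_max mulr_ge0 ?divr_ge0//; last exact: ltW.
  by rewrite lerBlDr (le_trans tn)// -natr1 mulrDl mul1r.
rewrite (total_variationD f c0 ct) -natr1 EFinD; apply: leeD.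
  exact: IH (le_trans ct tT) cn.
have [ctE|ct'] := eqVneq c t.
  by rewrite ctE total_variationxx lee_fin ler01.
have := sum_total_variation_le fr (s := [:: (c, t)]).
rewrite !big_seq1/=; apply.
- by rewrite /itv_family/= c0 lt_neqAle ct' ct tT.
- have : t - r / 2 <= c by rewrite le_max lexx orbT.
  by move: r0; lra.
Qed.

Lemma ac_total_variationB T f x y : ac_fun T f -> 0 <= x -> x <= y -> y <= T ->
  total_variation x y f =
  (fine (total_variation 0 y f) - fine (total_variation 0 x f))%:E.
Proof.
move=> acf x0 xy yT.
have finx := ac_total_variation_fin_num acf x0 (le_trans xy yT).
have := ac_total_variation_fin_num acf (le_trans x0 xy) yT.
rewrite (total_variationD f x0 xy) fin_numD => /andP[_ finxy].
by rewrite fineD// addrAC subrr add0r fineK.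
Qed.

(** Increments of the total variation are the total variations of the
    intervals, which [sum_total_variation_le] controls together. *)
Lemma ac_total_variation T f : ac_fun T f ->
  ac_fun T (fun t => fine (total_variation 0 t f)).
Proof.
move=> acf e e0; have [r r0 fr] := acf e e0; exists r => // s sT sr.
have := sum_total_variation_le fr sT sr; rewrite -lee_fin -sumEFin.
apply: le_trans; rewrite big_seq [leRHS]big_seq lee_sum// => -[a b] xs /=.
case/andP: sT => /allP/(_ _ xs)/and3P[/= a0 /ltW ab bT] _.
have := total_variation_ge0 f ab.
by rewrite (ac_total_variationB acf a0 ab bT) !lee_fin => /ger0_norm ->.
Qed.

(** Lebesgue-Stieltjes measures are attached to functions on the whole line;
    composition with [clamp T] extends by constants outside $[0, T]$. *)
Definition clamp T (t : R) := Num.max 0 (Num.min t T).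

Lemma clamp_id T t : 0 <= t -> t <= T -> clamp T t = t.
Proof. by move=> t0 tT; rewrite /clamp (min_idPl tT) (max_idPr t0). Qed.

Lemma clamp_ge0 T t : 0 <= clamp T t.
Proof. by rewrite le_max lexx. Qed.

Lemma clamp_le T t : 0 <= T -> clamp T t <= T.
Proof. by move=> T0; rewrite ge_max T0 ge_min lexx orbT. Qed.

Lemma clamp_nd T : nondecreasing (clamp T).
Proof.
move=> x y xy; rewrite /clamp ge_max !le_max lexx/= orbC.
rewrite (_ : Num.min x T <= Num.min y T) ?orbT//.
by rewrite le_min !ge_min xy lexx orbT.
Qed.

Lemma clamp_dist T x y : x <= y -> clamp T y - clamp T x <= y - x.
Proof.
move=> xy; rewrite /clamp; case: (leP x T) => ?; case: (leP y T) => ?;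
  case: (leP 0 T) => ?; case: (leP 0 x) => ?; case: (leP 0 y) => ?; lra.
Qed.

Lemma ac_fun_clamp_continuous T f : 0 <= T -> ac_fun T f ->
  continuous (f \o clamp T).
Proof.
move=> T0 acf x; apply/cvgrPdist_le => e e0.
have [r r0 fr] := acf e e0.
have H a b : a <= b -> b - a < r ->
    `|(f \o clamp T) b - (f \o clamp T) a| <= e.
  move=> ab abr /=; have [->|cab] := eqVneq (clamp T b) (clamp T a).
    by rewrite subrr normr0 ltW.
  have := fr [:: (clamp T a, clamp T b)]; rewrite !big_seq1/=; apply.
    rewrite /itv_family/= clamp_ge0 clamp_le// lt_neqAle eq_sym cab/=.
    by rewrite clamp_nd.
  exact: le_lt_trans (clamp_dist _ ab) abr.
near=> y; have xyr : `|x - y| < r by near: y; apply: cvgr_dist_lt.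
have [xy|/ltW yx] := leP x y.
  by rewrite distrC; apply: H => //; rewrite ler0_norm ?opprB ?subr_le0 in xyr.
by apply: H => //; rewrite ger0_norm ?subr_ge0 in xyr.
Unshelve. all: by end_near. Qed.

Lemma lebesgue_stieltjes_itv (F : cumulative R R) (a b : R) : a <= b ->
  lebesgue_stieltjes_measure F `]a, b]%classic = (F b - F a)%:E.
Proof.
move=> ab; rewrite /lebesgue_stieltjes_measure /measure_extension/=.
rewrite measurable_mu_extE/=; last exact: is_ocitv.
by rewrite wlength_itv_bnd.
Qed.

Lemma lebesgue_stieltjes_family (F : cumulative R R) T s : itv_family T s ->
  lebesgue_stieltjes_measure F (\big[setU/set0]_(x <- s) `]x.1, x.2]%classic)
  = (\sum_(x <- s) (F x.2 - F x.1))%:E.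
Proof.
elim: s => [|[a b] s IH] absT; first by rewrite !big_nil measure0.
have sT := itv_family_cons absT.
have mitv (x : R * R) :
    measurable (`]x.1, x.2]%classic : set (measurableTypeR R)).
  exact: measurable_itv.
rewrite !big_cons/= measureU//.
- rewrite EFinD; congr (_ + _)%E; last exact: IH.
  by apply: lebesgue_stieltjes_itv; case/andP: absT => /= /andP[/and3P[_ /ltW]].
- by apply: bigsetU_measurable => x _; exact: mitv.
- apply/seteqP; split => // z [/= + zs].
  rewrite in_itv/= => /andP[az zb].
  rewrite -bigcup_seq in zs; case: zs => x /= xs.
  rewrite in_itv/= => /andP[xz zx].
  case/andP: absT => _ /= /andP[/allP/(_ _ xs)/orP[/=|/=] h _].
    by have := lt_le_trans xz (le_trans zb h); rewrite ltxx.
  by have := lt_le_trans az (le_trans zx h); rewrite ltxx.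
Qed.

End absolutely_continuous_density.

(** * Inner dyadic approximation of open sets *)

Section dyadic_approximation.
Context {R : realType}.
Implicit Types (T : R) (f g : R -> R) (s : seq (R * R)) (U : set R).
Local Notation mu := (@lebesgue_measure R).

Definition dyadic_cell T n k :=
  (k%:R * (T / 2 ^+ n), k.+1%:R * (T / 2 ^+ n)).

Definition inner_cells T U n : seq (R * R) :=
  [seq dyadic_cell T n k | k <- iota 0 (2 ^ n) &
     `[< `](dyadic_cell T n k).1, (dyadic_cell T n k).2]%classic `<=` U >]].

(** For fixed [n] the cells are disjoint intervals, to which absolute
    continuity applies; as [n] grows they exhaust the open set [U] inside
    $]0, T]$. *)
Definition inner_approx T U n : set (measurableTypeR R) :=
  \big[setU/set0]_(x <- inner_cells T U n) `]x.1, x.2]%classic.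

Lemma inner_cells_family T U n : 0 < T -> itv_family T (inner_cells T U n).
Proof.
move=> T0; have h0 : 0 < T / 2 ^+ n by rewrite divr_gt0// exprn_gt0.
apply/andP; split.
  rewrite /inner_cells all_map; apply/allP => k /=.
  rewrite mem_filter mem_iota/= add0n => /andP[_ kn].
  rewrite mulr_ge0 ?(ltW h0)// ltr_pM2r// ltr_nat ltnSn/=.
  by rewrite mulrCA ger_pMr// ler_pdivrMr ?exprn_gt0// mul1r -natrX ler_nat.
rewrite /inner_cells pairwise_map; apply: pairwise_filter.
have : pairwise ltn (iota 0 (2 ^ n)).
  by rewrite -(sorted_pairwise ltn_trans) iota_ltn_sorted.
apply: sub_pairwise => j k jk; apply/orP; left => /=.
by rewrite ler_pM2r// ler_nat.
Qed.

Lemma inner_approxP T U n x : inner_approx T U n x <->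
  exists k, [/\ (k < 2 ^ n)%N,
    x \in `](dyadic_cell T n k).1, (dyadic_cell T n k).2] &
    `](dyadic_cell T n k).1, (dyadic_cell T n k).2]%classic `<=` U].
Proof.
rewrite /inner_approx -bigcup_seq; split.
  move=> [y /= /mapP[k + ->]]; rewrite mem_filter mem_iota/= add0n.
  by move=> /andP[/asboolP kU kn] xk; exists k.
move=> [k [kn xk kU]]; exists (dyadic_cell T n k) => //=.
apply/mapP; exists k => //; rewrite mem_filter mem_iota/= add0n kn andbT.
exact/asboolP.
Qed.

Lemma inner_approx_sub T U n : inner_approx T U n `<=` U.
Proof. by move=> x /inner_approxP[k [_ xk]]; apply. Qed.

Lemma measurable_inner_approx T U n : measurable (inner_approx T U n).
Proof. by apply: bigsetU_measurable => x _; exact: measurable_itv. Qed.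

Lemma inner_approx_nd T U : 0 < T ->
  {homo inner_approx T U : n m / (n <= m)%N >-> (n <= m)%O}.
Proof.
move=> T0; apply: (@homo_leq _ _ (fun A B => (A <= B)%O)) => //.
- by move=> ? ? ?; exact: le_trans.
move=> n; apply/subsetPset => x /inner_approxP[k [kn xk kU]].
apply/inner_approxP.
pose h := T / 2 ^+ n.+1.
have h0 : 0 < h by rewrite divr_gt0// exprn_gt0.
have hE : T / 2 ^+ n = 2 * h.
  by rewrite /h exprS invfM mulrCA mulVKf.
move: xk kU; rewrite /dyadic_cell/= -/h hE => xk kU.
have lo : k%:R * (2 * h) = (k.*2)%:R * h by rewrite -muln2 natrM mulrA.
have hi : k.+1%:R * (2 * h) = (k.*2.+2)%:R * h.
  by rewrite -doubleS -muln2 natrM mulrA.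
rewrite lo hi in xk kU.
have kn' : (k.*2.+1 < 2 ^ n.+1)%N by rewrite expnS mul2n -doubleS leq_double.
have [xm|xm] := leP x ((k.*2.+1)%:R * h).
- exists k.*2; split.
  + by rewrite (ltn_trans (ltnSn _)).
  + by move: xk; rewrite !in_itv/= xm => /andP[->].
  + apply: subset_trans kU; apply: subset_itvl; rewrite bnd_simp.
    by rewrite ler_pM2r// ler_nat.
- exists k.*2.+1; split => //.
  + by move: xk; rewrite !in_itv/= xm => /andP[_ ->].
  + apply: subset_trans kU; apply: subset_itvr; rewrite bnd_simp.
    by rewrite ler_pM2r// ler_nat.
Qed.

Lemma inner_approx_cover T U : 0 < T -> open U ->
  U `&` `]0, T]%classic `<=` \bigcup_n inner_approx T U n.
Proof.
move=> T0 oU x [Ux]; rewrite /= in_itv/= => /andP[x0 xT].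
have /nbhs_ballP[e /= e0 xeU] : nbhs x U by apply: open_nbhs_nbhs.
(* [n < 2 ^ n], so that cells of this generation are shorter than [e] *)
pose n := Num.bound (T / e); pose h := T / 2 ^+ n.
have h0 : 0 < h by rewrite divr_gt0// exprn_gt0.
have he : h < e.
  rewrite ltr_pdivrMr ?exprn_gt0// mulrC -ltr_pdivrMr//.
  apply: lt_trans (archi_boundP _) _; first by rewrite divr_ge0// ltW.
  by rewrite -natrX ltr_nat ltn_expl.
have xP : exists k, x <= k.+1%:R * h.
  exists (2 ^ n)%N; apply: le_trans xT _.
  by rewrite mulrCA ler_pMr// ler_pdivlMr ?exprn_gt0// mul1r -natrX ler_nat.
case: (ex_minnP xP) => k xk kmin; exists n => //; apply/inner_approxP.
have kx : k%:R * h < x.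
  case: k kmin {xk} => [_|k kmin]; first by rewrite mul0r.
  by rewrite ltNge; apply/negP => /kmin; rewrite ltnn.
exists k; split.
- rewrite -(prednK (expn_gt0 2 n)) ltnS kmin// prednK ?expn_gt0//.
  by rewrite natrX mulrCA divff ?mulr1// expf_neq0.
- by rewrite in_itv/= kx.
- move=> y; rewrite /= in_itv/= -/h => /andP[ky yk]; apply: xeU.
  rewrite /ball/= (le_lt_trans _ he)//.
  have : k.+1%:R * h = k%:R * h + h by rewrite -natr1 mulrDl mul1r.
  by move=> kE; rewrite kE in xk yk; rewrite ler_norml; apply/andP; split; lra.
Qed.

(** A null set has open neighbourhoods of arbitrarily small length, and by
    absolute continuity [F] increases little along the dyadic cells inside
    them. *)
Lemma ac_cumulative_null (F : cumulative R R) T (B : set (measurableTypeR R)) :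
  0 < T -> ac_fun T F -> measurable B -> mu B = 0%E ->
  lebesgue_stieltjes_measure F (B `&` `]0, T]%classic) = 0%E.
Proof.
move=> T0 acF mB B0.
have mD : measurable (`]0, T]%classic : set (measurableTypeR R)).
  exact: measurable_itv.
apply/eqP; rewrite -measure_le0; apply/lee_addgt0Pr => e e0; rewrite add0e.
have [r r0 Fr] := acF e e0.
have [U [oU BU Ur]] : exists U, [/\ open U, B `<=` U & (mu U < r%:E)%E].
  have muBoo : (mu B < +oo)%E by rewrite B0 ltry.
  have [U [oU BU Ur]] := @lebesgue_regularity_outer _ B r mB muBoo r0.
  exists U; split => //.
  rewrite (measureDI mu (A := U) (B := B))//; last first.
    exact: open_measurable.
  by rewrite setIC setIidl// [X in (_ + X)%E]B0 adde0.
have mU : measurable (U : set (measurableTypeR R)) by exact: open_measurable.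
have mW := measurable_inner_approx T U.
have mWU := bigcupT_measurable _ mW.
apply: (@le_trans _ _
    (lebesgue_stieltjes_measure F (\bigcup_n inner_approx T U n))).
  rewrite le_measure ?inE//; first exact: measurableI.
  by apply: subset_trans (inner_approx_cover T0 oU); exact: setSI.
have := nondecreasing_cvg_mu (mu := lebesgue_stieltjes_measure F) mW mWU
  (@inner_approx_nd T U T0).
move=> /[dup] /cvgP Wc /cvg_lim <-//; apply: lime_le => //.
apply: nearW => n /=.
have sT := inner_cells_family U n T0.
rewrite (lebesgue_stieltjes_family F sT) lee_fin.
apply: le_trans (Fr _ sT _); first by apply: ler_sum => x _; exact: ler_norm.
rewrite -lte_fin -(lebesgue_stieltjes_family idfun sT).
have : (mu (inner_approx T U n) <= mu U)%E.
  by apply: (le_measure mu); rewrite ?inE//; exact: inner_approx_sub.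
by move=> /le_lt_trans; apply.
Qed.

End dyadic_approximation.

(** * The fundamental theorem of calculus *)

Section density.
Context {R : realType}.
Implicit Types (T : R) (f g : R -> R).
Local Notation mu := (@lebesgue_measure R).

Lemma ac_fun_clamp T f : 0 <= T -> ac_fun T f -> ac_fun T (f \o clamp T).
Proof.
move=> T0 acf e e0; have [r r0 fr] := acf e e0; exists r => // s sT sr.
rewrite (le_trans _ (fr s sT sr))// big_seq [leRHS]big_seq ler_sum// => x xs.
case/andP: sT => /allP/(_ _ xs)/and3P[x10 /ltW x12 x2T] _ /=.
by rewrite !clamp_id// ?(le_trans x12)// (le_trans x10).
Qed.

(** The density is the Radon-Nikodym derivative of the Lebesgue-Stieltjes
    measure of [f]. *)
Lemma nondecreasing_ac_density T f : 0 < T ->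
  {in `[0, T] &, nondecreasing_fun f} -> ac_fun T f ->
  exists2 rho : R -> R, mu.-integrable setT (EFin \o rho) &
    forall t, 0 <= t -> t <= T -> f t - f 0 = \int[mu]_(x in `]0, t]) rho x.
Proof.
move=> T0 ndf acf; have T0' := ltW T0.
have ndF : nondecreasing (f \o clamp T).
  move=> x y xy /=; apply: ndf; rewrite ?in_itv/= ?clamp_ge0 ?clamp_le//.
  exact: clamp_nd.
have rcF : right_continuous (f \o clamp T).
  exact/right_continuousW/ac_fun_clamp_continuous.
pose F : cumulative R R := HB.pack (f \o clamp T)
  (isCumulative.Build R _ R (f \o clamp T) ndF rcF).
pose D : set (measurableTypeR R) := `]0, T]%classic.
have mD : measurable D by exact: measurable_itv.
have Doo : (lebesgue_stieltjes_measure F D < +oo)%E.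
  by rewrite /D lebesgue_stieltjes_itv// ltry.
pose nu : {finite_measure set (measurableTypeR R) -> \bar R} := mfrestr mD Doo.
have numu : nu `<< mu.
  move=> N N0 A mA AN; rewrite /nu/= /mfrestr /mrestr.
  apply: ac_cumulative_null => //; first exact: ac_fun_clamp.
  exact: N0.
have [h [h0 hfin hint nuE]] := radon_nikodym_sigma_finite numu.
exists (fine \o h) => [|t t0 tT].
  by apply: eq_integrable hint => // x _ /=; rewrite fineK.
have mt : measurable (`]0, t]%classic : set (measurableTypeR R)).
  exact: measurable_itv.
have := nuE _ mt; rewrite /nu/= /mfrestr /mrestr setIidl; last first.
  by apply: subset_itvl; rewrite bnd_simp.
rewrite lebesgue_stieltjes_itv//= !clamp_id// => fE.
rewrite /Rintegral; under eq_integral do rewrite /= fineK//.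
by rewrite -fE.
Qed.

(** Jordan decomposition: [f] is the difference of its total variation [V] and
    of [V - f]. *)
Lemma ac_density T f : 0 < T -> ac_fun T f ->
  exists2 rho : R -> R, mu.-integrable setT (EFin \o rho) &
    forall t, 0 <= t -> t <= T -> f t - f 0 = \int[mu]_(x in `]0, t]) rho x.
Proof.
move=> T0 acf; pose V t := fine (total_variation 0 t f).
have acV : ac_fun T V := ac_total_variation acf.
have fV x y : 0 <= x -> x <= y -> y <= T -> `|f y - f x| <= V y - V x.
  move=> x0 xy yT; rewrite -lee_fin -(ac_total_variationB acf x0 xy yT).
  exact: total_variation_ge.
have [r1 ir1 r1E] : exists2 rho : R -> R, mu.-integrable setT (EFin \o rho) &
    forall t, 0 <= t -> t <= T -> V t - V 0 = \int[mu]_(x in `]0, t]) rho x.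
  apply: nondecreasing_ac_density => // x y; rewrite !in_itv/=.
  move=> /andP[x0 _] /andP[_ yT] xy; rewrite -subr_ge0.
  exact: le_trans (fV _ _ x0 xy yT).
have [r2 ir2 r2E] : exists2 rho : R -> R, mu.-integrable setT (EFin \o rho) &
    forall t, 0 <= t -> t <= T ->
      (V \- f) t - (V \- f) 0 = \int[mu]_(x in `]0, t]) rho x.
  apply: nondecreasing_ac_density => //; last exact: ac_funB.
  move=> x y; rewrite !in_itv/= => /andP[x0 _] /andP[_ yT] xy.
  have := le_trans (ler_norm _) (fV _ _ x0 xy yT); lra.
exists (r1 \- r2) => [|t t0 tT].
  by apply: eq_integrable (integrableB measurableT ir1 ir2).
have mt : measurable (`]0, t]%classic : set R) by exact: measurable_itv.
rewrite RintegralB//; [|exact: integrableS ir1..|exact: integrableS ir2].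
rewrite -r1E// -r2E//=; lra.
Qed.

(** Almost every point is a Lebesgue point of the density, and there the
    indefinite integral is derivable. *)
Lemma ac_derivable T f : 0 < T -> ac_fun T f ->
  exists2 rho : R -> R, mu.-integrable setT (EFin \o rho) &
    f T - f 0 = \int[mu]_(x in `]0, T[) rho x /\
    {ae mu, forall x, 0 < x -> x < T -> derivable f x 1 /\ 'D_1 f x = rho x}.
Proof.
move=> T0 acf; have [rho irho rhoE] := ac_density T0 acf; exists rho => //.
split.
  rewrite rhoE ?(ltW T0)// -Rintegral_itv_bndo_bndc//.
  exact: integrableS irho.
have /FTC1 : forall y,
    mu.-integrable [set` Interval (BRight 0) (BRight y)] (EFin \o rho).
  by move=> y; apply: integrableS irho.
have locrho : locally_integrable setT rho.
  exact: open_integrable_locally openT irho.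
move=> /(_ locrho); apply: filterS; first exact: (ae_filter_ringOfSetsType mu).
move=> x Fx x0 xT.
have {Fx}[dF FE] := Fx x0.
set F := (fun y => _) in dF FE.
have Ff : \forall y \near x, (F + cst (f 0)) y = f y.
  near=> y; rewrite /F fctE -rhoE ?subrK//.
  - by apply: ltW; near: y; exact: lt_nbhsr.
  - by apply: ltW; near: y; exact: lt_nbhsl.
have dc : derivable (cst (f 0) : R -> R) x 1 by exact: derivable_cst.
split; first by apply: near_eq_derivable Ff _; exact: derivableD.
by rewrite -(near_eq_derive _ Ff) deriveD// derive_cst addr0 -FE derive1E.
Unshelve. all: by end_near. Qed.

End density.

(** * Lower bound on the kinetic energy *)

(** The derivative of an absolutely continuous curve agrees only almost
    everywhere with a measurable function, which is why [g] is compared with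
    [f] through the simple functions that lie below. *)
Lemma integral_le_ae_ge0 d (X : measurableType d) (R : realType)
    (mu : {measure set X -> \bar R}) (D E : set X) (f g : X -> \bar R) :
  measurable D -> D `<=` E -> mu.-integrable D f ->
  (forall x, E x -> 0 <= g x)%E -> {ae mu, forall x, D x -> (f x <= g x)%E} ->
  (\int[mu]_(x in D) f x <= \int[mu]_(x in E) g x)%E.
Proof.
move=> mD DE fint g0 [N [mN N0 Nfg]].
rewrite (negligible_integral mN mD fint N0).
have mDN : measurable (D `\` N) by exact: measurableD.
apply: (@le_trans _ _ (\int[mu]_(x in D `\` N) f^\+ x)%E).
  rewrite integralE leeBlDr; last first.
    apply: integrable_fin_num => //; apply: integrable_funeneg => //.
    by apply: integrableS fint => //; exact: subDsetl.
  by rewrite leeDl// integral_ge0.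
rewrite !ge0_integralE//; apply: le_ereal_sup => _ [h /= hf <-].
exists h => // x; apply: (le_trans (hf x)); rewrite !patchE.
case: ifPn => [|_]; last by case: ifPn => // /set_mem/g0.
rewrite inE => -[Dx Nx]; rewrite mem_set; last exact: DE.
rewrite funeposE ge_max g0 ?andbT; last exact: DE.
by apply: contrapT => fgx; apply: Nx; apply: Nfg => /= /(_ Dx).
Qed.

Section kinetic_energy.
Context {R : realType} {d : nat}.
Implicit Types (T : R) (g : R -> 'rV[R]_d) (u v : 'rV[R]_d).
Local Notation mu := (@lebesgue_measure R).

Definition dotv u v : R := \sum_(i < d) u ord0 i * v ord0 i.

Lemma norm2_sqr v : norm2 v ^+ 2 = \sum_(i < d) v ord0 i ^+ 2.
Proof. by rewrite sqr_sqrtr// sumr_ge0// => i _; exact: sqr_ge0. Qed.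

Lemma norm2_coord v i : `|v ord0 i| <= norm2 v.
Proof.
rewrite -sqrtr_sqr /norm2 ler_wsqrtr// (bigD1 i)//= lerDl sumr_ge0// => j _.
exact: sqr_ge0.
Qed.

Lemma dotv_le u v : `|dotv u v| <= (\sum_(i < d) `|u ord0 i|) * norm2 v.
Proof.
rewrite mulr_suml (le_trans (ler_norm_sum _ _ _))// ler_sum// => i _.
by rewrite normrM ler_wpM2l// norm2_coord.
Qed.

Lemma dotvB u v w : dotv u (v - w) = dotv u v - dotv u w.
Proof. by rewrite -sumrB; apply: eq_bigr => i _; rewrite !mxE mulrBr. Qed.

Lemma dotvZ (c : R) u v : dotv (c *: u) v = c * dotv u v.
Proof. by rewrite mulr_sumr; apply: eq_bigr => i _; rewrite mxE mulrA. Qed.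

Lemma dotvv v : dotv v v = norm2 v ^+ 2.
Proof. by rewrite norm2_sqr; apply: eq_bigr => i _; rewrite expr2. Qed.

Lemma norm2Z (c : R) v : norm2 (c *: v) ^+ 2 = c ^+ 2 * norm2 v ^+ 2.
Proof.
rewrite !norm2_sqr mulr_sumr; apply: eq_bigr => i _.
by rewrite mxE exprMn.
Qed.

(** Young's inequality bounds the energy below by an affine function of the
    velocity, which integrates to an increment of the curve. *)
Lemma dotv_young u v : dotv u v - 2^-1 * norm2 u ^+ 2 <= 2^-1 * norm2 v ^+ 2.
Proof.
rewrite !norm2_sqr lerBlDr !mulr_sumr -big_split/= ler_sum// => i _.
have := sqr_ge0 (u ord0 i - v ord0 i); rewrite sqrrB; lra.
Qed.

(** Only the scalar function [dotv u g] has to be integrated; the coordinates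
    of [g] serve to know that the vector derivative exists almost
    everywhere. *)
Lemma ae_dotv_derive T g u : 0 < T -> abs_continuous T g ->
  exists2 rho : R -> R, mu.-integrable setT (EFin \o rho) &
    dotv u (g T - g 0) = \int[mu]_(x in `]0, T[) rho x /\
    {ae mu, forall x, 0 < x -> x < T -> dotv u (derive1 g x) = rho x}.
Proof.
move=> T0 acg.
have acu : ac_fun T (fun t => dotv u (g t)).
  apply: (abs_continuous_lipschitz acg) => a b.
  by rewrite -dotvB; exact: dotv_le.
have [rho irho [rhoE rhoD]] := ac_derivable T0 acu.
exists rho => //; split; first by rewrite dotvB.
have gD : {ae mu, forall x, forall i : 'I_d, 0 < x -> x < T ->
    derivable (fun t => g t ord0 i) x 1}.
  apply: filter_forall => i.
  have aci : ac_fun T (fun t => g t ord0 i).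
    apply: (abs_continuous_lipschitz (C := 1) acg) => a b.
    by rewrite mul1r; have := norm2_coord (g b - g a) i; rewrite !mxE.
  have [rhoi _ [_ +]] := ac_derivable T0 aci.
  apply: filterS; first exact: (ae_filter_ringOfSetsType mu).
  by move=> x xD x0 xT; have [] := xD x0 xT.
apply: filterS2 rhoD gD; first exact: (ae_filter_ringOfSetsType mu).
move=> x fD gD x0 xT; have [_ <-] := fD x0 xT.
have dg : derivable g x 1.
  by apply/derivable_mxP => i j; rewrite ord1; exact: gD.
rewrite derive1E (derive_mx dg).
transitivity (\sum_(i < d) 'D_1 (u ord0 i *: (fun t => g t ord0 i)) x).
  apply: eq_bigr => i _; rewrite mxE deriveZ//; exact: gD.
rewrite -derive_sum.
  congr ('D_1 _ x); apply/funext => t.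
  by rewrite fct_sumE; apply: eq_bigr.
by move=> i; apply: derivableZ; exact: gD.
Qed.

(** Jensen's inequality in disguise: the test vector [u] is the mean velocity,
    for which the inequality of [dotv_young] is an equality along the straight
    line. *)
Lemma kinetic_energy_ge T g : 0 < T -> abs_continuous T g ->
  (((2 * T)^-1 * norm2 (g T - g 0) ^+ 2)%:E <=
   \int[mu]_(s in `[0%R, T]) (2^-1 * norm2 (derive1 g s) ^+ 2)%:E)%E.
Proof.
move=> T0 acg; pose u := T^-1 *: (g T - g 0).
have [rho irho [rhoE rhoD]] := ae_dotv_derive u T0 acg.
pose c : R -> R := cst (2^-1 * norm2 u ^+ 2).
pose f x := rho x - c x.
have mI : measurable (`]0, T[%classic : set R) by exact: measurable_itv.
have muI : mu (`]0, T[%classic : set R) = T%:E.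
  by rewrite lebesgue_measure_itv/= lte_fin T0 oppr0 adde0.
have muIoo : (mu (`]0%R, T[%classic : set R) < +oo)%E by rewrite muI ltry.
have ic : mu.-integrable `]0, T[%classic
    (EFin \o c).
  apply: measurable_bounded_integrable => //.
  exact: measurable_cst.
  exact: bounded_cst.
have irho' : mu.-integrable `]0, T[%classic (EFin \o rho).
  exact: integrableS irho.
have if_ : mu.-integrable `]0, T[%classic (EFin \o f).
  rewrite (_ : EFin \o f =
    ((EFin \o rho) \- (EFin \o c))%E)//.
  exact: integrableB.
apply: (@le_trans _ _ (\int[mu]_(s in `]0%R, T[) (f s)%:E)%E); last first.
  apply: integral_le_ae_ge0 => //.
  - by move=> x; rewrite /= !in_itv/= => /andP[/ltW -> /ltW ->].
  - by move=> x _; rewrite lee_fin mulr_ge0// sqr_ge0.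
  - apply: filterS rhoD; first exact: (ae_filter_ringOfSetsType mu).
    move=> x xD; rewrite /= in_itv/= => /andP[x0 xT].
    by rewrite lee_fin /f -(xD x0 xT) dotv_young.
have -> : (\int[mu]_(s in `]0%R, T[) (f s)%:E)%E =
    (\int[mu]_(s in `]0%R, T[) f s)%:E.
  by rewrite /Rintegral fineK//; exact: integrable_fin_num.
rewrite RintegralB// -rhoE Rintegral_cst// [X in fine X]muI.
rewrite lee_fin /u dotvZ norm2Z dotvv.
rewrite le_eqVlt; apply/orP; left; apply/eqP.
have H (t n : R) : t != 0 ->
  (2 * t)^-1 * n = t^-1 * n - 2^-1 * (t^-1 ^+ 2 * n) * t by move=> ?; field.
by apply: H; rewrite gt_eqF.
Qed.

End kinetic_energy.

(** * Straight lines are optimal *)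

Section straight_curves.
Context {R : realType} {d : nat} {T : R}.
Implicit Types (x y : 'rV[R]_d).
Local Notation mu := (@lebesgue_measure R).

(** The value outside $[0, T]$ follows the representation of curves in
    [curve]. *)
Definition straight_fun x y (t : R) : 'rV[R]_d :=
  if t \in `[0, T] then x + (t / T) *: (y - x) else 0.

Lemma straight_fun_in x y t : 0 <= t -> t <= T ->
  straight_fun x y t = x + (t / T) *: (y - x).
Proof. by move=> t0 tT; rewrite /straight_fun in_itv/= t0 tT. Qed.

Lemma straight_fun0 x y : 0 <= T -> straight_fun x y 0 = x.
Proof. by move=> T0; rewrite straight_fun_in// mul0r scale0r addr0. Qed.

Lemma straight_funT x y : 0 < T -> straight_fun x y T = y.
Proof.
move=> T0; rewrite straight_fun_in// ?ltW// divff ?gt_eqF// scale1r.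
by rewrite addrC subrK.
Qed.

Lemma straight_fun_AC x y : 0 < T -> straight_fun x y \in Defs.AC R d T.
Proof.
move=> T0; rewrite inE; split; last first.
  by move=> t tT; rewrite /straight_fun (negbTE tT).
move=> e e0; pose C := norm2 (y - x) / T + 1.
have C0 : 0 < C by rewrite ltr_wpDl// divr_ge0 ?sqrtr_ge0// ltW.
exists (e / C) => [|n a b abT _]; first exact: divr_gt0.
rewrite ltr_pdivlMr//; apply: le_lt_trans.
rewrite mulr_suml; apply: ler_sum => i _.
have [ai [ab bi]] := abT i; have ba : 0 <= b i - a i by rewrite subr_ge0 ltW.
rewrite !straight_fun_in ?(le_trans ai (ltW ab))// ?(le_trans (ltW ab))//.
have -> : x + b i / T *: (y - x) - (x + a i / T *: (y - x)) =
    ((b i - a i) / T) *: (y - x).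
  by rewrite opprD addrACA subrr add0r -scalerBl -mulrBl.
have -> : norm2 (((b i - a i) / T) *: (y - x)) =
    (b i - a i) * (norm2 (y - x) / T).
  apply/eqP; rewrite -(eqrXn2 (n := 2))// ?sqrtr_ge0//; last first.
    by rewrite mulr_ge0// divr_ge0 ?sqrtr_ge0// ltW.
  by rewrite norm2Z !exprMn; apply/eqP; ring.
by rewrite ler_wpM2l// lerDl.
Qed.

Definition straight (T0 : 0 < T) x y : curve R d T :=
  exist (fun g => g \in Defs.AC R d T) (straight_fun x y)
    (straight_fun_AC x y T0).

Lemma straight_funD x y (s : R) : 0 < s -> s < T ->
  derive1 (straight_fun x y) s = T^-1 *: (y - x).
Proof.
move=> s0 sT; apply/lim_near_cst => //; near=> h.
have h0 : h != 0 by near: h; exact: nbhs_dnbhs_neq.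
have hs : `|h| < Num.min s (T - s).
  by near: h; apply: dnbhs0_lt; rewrite lt_min s0 subr_gt0.
move: hs; rewrite lt_min !ltr_norml => /andP[/andP[? ?] /andP[? ?]].
have hs0 : 0 <= h + s by lra.
have hsT : h + s <= T by lra.
rewrite !straight_fun_in ?(ltW s0) ?(ltW sT)//.
rewrite opprD addrACA subrr add0r -scalerBl -mulrBl addrK scalerA.
by rewrite mulrA mulVf// mul1r.
Unshelve. all: by end_near. Qed.

Lemma straight_energy x y : 0 < T ->
  (\int[mu]_(s in `[0%R, T])
     (2^-1 * norm2 (derive1 (straight_fun x y) s) ^+ 2)%:E =
   ((2 * T)^-1 * norm2 (y - x) ^+ 2)%:E)%E.
Proof.
move=> T0; pose c : R := 2^-1 * norm2 (T^-1 *: (y - x)) ^+ 2.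
have E : {in `]0%R, T[%classic,
    (fun s => (2^-1 * norm2 (derive1 (straight_fun x y) s) ^+ 2)%:E) =1
    cst c%:E}.
  move=> s; rewrite inE/= in_itv/= => /andP[s0 sT].
  by rewrite /c straight_funD.
have mf : measurable_fun (`]0%R, T[%classic : set R)
    (fun s : R => (2^-1 * norm2 (derive1 (straight_fun x y) s) ^+ 2)%:E).
  apply: (@eq_measurable_fun _ _ _ _ _ (cst c%:E)); last exact: measurable_cst.
  by move=> s /E ->.
rewrite (integral_itv_bndoo _ _ mf).
transitivity (\int[mu]_(s in `]0%R, T[) cst c%:E s)%E; first exact: eq_integral.
rewrite integral_cst//.
rewrite [X in (_ * X)%E]lebesgue_measure_itv/= lte_fin T0 oppr0 adde0 -EFinM.
congr _%:E; rewrite /c norm2Z.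
have H (t n : R) : t != 0 ->
  2^-1 * (t^-1 ^+ 2 * n) * t = (2 * t)^-1 * n by move=> ?; field.
by apply: H; rewrite gt_eqF.
Qed.

(** What an agent pays in total for ending at [y] when travelling there at the
    least running cost, in a population with [sigmaT] equal to [S]. *)
Definition reduced_cost (phi : 'rV[R]_d -> R) (x : 'rV[R]_d) (S : R) y : R :=
  (2 * T)^-1 * norm2 (y - x) ^+ 2 + phi y * S.

(** [kinetic_energy_ge] bounds the cost of a competitor below by the reduced
    cost of its endpoint, with equality for straight lines. *)
Lemma straight_minimizer (T0 : 0 < T) (phi : 'rV[R]_d -> R)
    (sigma : probability 'rV[R]_d R -> R) (eta : probability (curve R d T) R)
    x y :
  let S := sigma (distribution eta (ev T)) in
  (forall z, reduced_cost phi x S y <= reduced_cost phi x S z) ->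
  minimizers (fun _ v => 2^-1 * norm2 v ^+ 2)
    (fun x m => phi x * sigma m) eta x (straight T0 x y).
Proof.
move=> S ymin; split; first exact/straight_fun0/ltW.
move=> h hx; rewrite /cost.
have -> : straight T0 x y T = y by exact: straight_funT.
rewrite -/S [X in (X + _ <= _)%E](straight_energy x y T0) -EFinD.
have [hAC _] := set_mem (valP h).
apply: (@le_trans _ _ (reduced_cost phi x S (h T))%:E).
  by rewrite lee_fin.
rewrite /reduced_cost EFinD leeD2r//.
have := kinetic_energy_ge T0 hAC.
by rewrite /curves_from/= in hx; rewrite [val h 0]hx.
Qed.

End straight_curves.

(** * Laws carried by two curves *)

Section two_point_laws.
Context {d : measure_display} {X : measurableType d} {R : realType}.
Implicit Types (m : probability X R) (a : R) (x y : X).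

Definition two_point_law a x y m := forall A, measurable A ->
  m A = (a%:E * \d_x A + (1 - a)%:E * \d_y A)%E.

Lemma two_point_law_exists a x y : 0 <= a <= 1 ->
  exists m, two_point_law a x y m.
Proof.
move=> a01; pose pt (b : bool) := if b then x else y.
have mpt : measurable_fun setT pt by [].
pose Xpt : {mfun bool >-> X} :=
  HB.pack pt (isMeasurableFun.Build _ _ _ _ pt mpt).
exists (distribution (bernoulli_prob a) Xpt) => A mA.
transitivity (bernoulli_prob a (pt @^-1` A)); first by [].
by rewrite bernoulli_probE// !diracE.
Qed.

Lemma Rintegral_two_point a x y m (f : X -> R) : two_point_law a x y m ->
  0 <= a <= 1 -> measurable_fun setT f -> (forall z, 0 <= f z) ->
  \int[m]_z f z = a * f x + (1 - a) * f y.
Proof.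
move=> mE /andP[a0 a1] mf f0; have a1' : 0 <= 1 - a by rewrite subr_ge0.
have mf' : measurable_fun setT (EFin \o f) by exact/measurable_EFinP.
have f0' : forall z, setT z -> (0 <= (f z)%:E)%E by move=> z _; rewrite lee_fin.
rewrite /Rintegral (eq_measure_integral
  (measure_add (mscale (NngNum a0) \d_x)
    (mscale (NngNum a1') \d_y))); last first.
  by move=> A mA _; rewrite [LHS]mE// -[RHS]/(measure_add _ _ A) measure_addE.
rewrite ge0_integral_measure_add// !ge0_integral_mscale//=.
by rewrite !integral_dirac// !diracT !mul1e.
Qed.

End two_point_laws.

Section equilibria.
Context {R : realType} {d : nat} {T : R}.
Implicit Types (x y : 'rV[R]_d) (gam h : curve R d T) (a : R).

Lemma measurable_rV_set1 x : measurable [set x].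
Proof.
have : closed [set x].
  by apply: accessible_closed_set1; exact: hausdorff_accessible.
move=> cx; rewrite -[[set x]]setCK; apply: measurableC.
by apply: sub_sigma_algebra; exact: closed_openC.
Qed.

Lemma continuous_measurable_rV (f : 'rV[R]_d -> R) :
  continuous f -> measurable_fun setT f.
Proof.
move=> /continuousP cf; apply: (measurability _ (RGenOpens.measurableE R)).
move=> _ [_ [a [b ->] <-]]; rewrite setTI; apply: sub_sigma_algebra.
by apply: cf; exact: interval_open.
Qed.

(** Curves vanish outside $[0, T]$, so distinct curves differ at a time where
    evaluation is continuous. *)
Lemma curve_separated gam h : gam <> h ->
  exists2 U : set (curve R d T), open U /\ U h & ~ U gam.
Proof.
move=> gh.
have [t t0T ght] : exists2 t, t \in `[0, T] & gam t <> h t.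
  apply: contrapT => nex; apply: gh; apply: val_inj; apply/funext => t.
  have [t0T|t0T] := boolP (t \in `[0, T]).
    by apply: contrapT => ?; apply: nex; exists t.
  by rewrite (set_mem (valP gam)).2// (set_mem (valP h)).2.
exists (ev t @^-1` ~` [set gam t]); last by move=> /=; exact.
split; last by move=> /= ht; apply: ght.
apply: (continuousP _).1 (continuous_ev t0T) _ _.
apply: closed_openC; apply: accessible_closed_set1; exact: hausdorff_accessible.
Qed.

Lemma support_two_point a gam1 gam2 (m : probability (curve R d T) R) :
  two_point_law a gam1 gam2 m -> Defs.support m `<=` [set gam1; gam2].
Proof.
move=> mE h hm; apply: contrapT => /not_orP[h1 h2].
have [U1 [oU1 hU1] gU1] := curve_separated (nesym h1).
have [U2 [oU2 hU2] gU2] := curve_separated (nesym h2).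
have oU : open (U1 `&` U2) by exact: openI.
have := hm _ oU (conj hU1 hU2).
rewrite mE; last exact: sub_sigma_algebra.
rewrite !diracE !memNset ?mule0 ?adde0 ?ltxx//; by case.
Qed.

Lemma ae_dirac x (P : 'rV[R]_d -> Prop) : P x ->
  {ae (\d_x : {measure set 'rV[R]_d -> \bar R}), forall y, P y}.
Proof.
move=> Px; exists (~` [set x]); split.
- by apply: measurableC; exact: measurable_rV_set1.
- by rewrite /= diracE memNset//; exact.
- by move=> y /= nPy yx; apply: nPy; rewrite yx.
Qed.

(** The initial law being a Dirac mass, the constant kernel [eta] disintegrates
    [eta], and its support is made of the two curves at most. *)
Lemma two_point_equilibrium (L : 'rV[R]_d -> 'rV[R]_d -> R)
    (G : 'rV[R]_d -> probability 'rV[R]_d R -> R) a x gam1 gam2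
    (eta : probability (curve R d T) R) :
  two_point_law a gam1 gam2 eta ->
  minimizers L G eta x gam1 -> minimizers L G eta x gam2 ->
  equilibrium L G \d_x eta.
Proof.
move=> etaE min1 min2; split.
  move=> B mB; rewrite /distribution /pushforward etaE; last first.
    by rewrite -[_ @^-1` _]setTI; exact: measurable_ev.
  rewrite !diracE.
  have ev0 gam : minimizers L G eta x gam ->
      (gam \in ev 0 @^-1` B) = (x \in B).
    by move=> [gx _]; rewrite -[in RHS]gx; apply/idP/idP; rewrite !inE.
  by rewrite (ev0 _ min1) (ev0 _ min2) -muleDl// -EFinD addrC subrK mul1e.
have mk : measurable_fun setT
    (fun _ : 'rV[R]_d => eta : pprobability (curve R d T) R) by [].
exists (kprobability mk).
  split.
    by move=> A mA; rewrite integral_dirac//= diracT mul1e.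
  by apply: ae_dirac => h /(support_two_point etaE)[] ->;
    [exact: min1.1|exact: min2.1].
by apply: ae_dirac => h /(support_two_point etaE)[] ->.
Qed.

End equilibria.

(** * The reduced fixed point problem *)

Section fixed_point.
Context {R : realType} {d : nat} {T : R}.
Variables (phi : 'rV[R]_d -> R) (x : 'rV[R]_d) (M : R).
Hypotheses (T0 : 0 < T) (phi_gt0 : forall y, 0 < phi y)
  (phi_le : forall y, phi y <= M) (phi_cont : continuous phi).
Implicit Types (y z : 'rV[R]_d) (S a : R).

Local Notation F := (@reduced_cost R d T phi x).

Definition reduced_minimizer S y := forall z, F S y <= F S z.

Let M_gt0 : 0 < M.
Proof. exact: lt_le_trans (phi_gt0 x) (phi_le x). Qed.

(** No value of [phi] reaches [B], hence [S = B] is never below [phi y]. *)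
Let B := M + 1.

Let kinetic y : R := (2 * T)^-1 * norm2 (y - x) ^+ 2.

Let kinetic_ge0 y : 0 <= kinetic y.
Proof. by rewrite mulr_ge0 ?sqr_ge0// invr_ge0 mulr_ge0// ltW. Qed.

Let kinetic_cont : continuous kinetic.
Proof.
have -> : kinetic =
    fun y => (2 * T)^-1 * \sum_(i < d) (y ord0 i - x ord0 i) ^+ 2.
  apply/funext => y; rewrite /kinetic norm2_sqr; congr (_ * _).
  by apply: eq_bigr => i _; rewrite !mxE.
have sum_cont : continuous
    (fun y : 'rV[R]_d => \sum_(i < d) (y ord0 i - x ord0 i) ^+ 2); last first.
  by move=> y; exact: (cvgM (cvg_cst _) (sum_cont y)).
apply: (@continuous_big R _ +%R) => [|i _ y]; first exact: add_continuous.
have H : continuous (fun y : 'rV[R]_d => y ord0 i - x ord0 i).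
  move=> z; apply: continuousB; first exact: coord_continuous.
  exact: cst_continuous.
exact: (cvg_comp _ _ (H y) (@exprn_continuous R 2 _)).
Qed.

Let K : set 'rV[R]_d := [set y | kinetic y <= M * B].

Let compact_K : compact K.
Proof.
apply: bounded_closed_compact; last first.
  exact: ((continuous_closedP kinetic).1 kinetic_cont _ (@closed_le R (M * B))).
(* [1 <= r] turns the bound on the squared norm into one on the norm *)
pose r := 2 * T * (M * B) + 1.
have B0 : 0 < B by rewrite addr_gt0.
have r1 : 1 <= r by rewrite lerDr mulr_ge0 ?mulr_ge0// ltW.
exists (`|x| + r); split; first exact: num_real.
move=> m xm y; rewrite /K/= /kinetic => yK; apply: le_trans (ltW xm).
have /(le_trans (ler_normD x (y - x))) : `|x| + `|y - x| <= `|x| + r.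
  rewrite lerD2l [leLHS]mx_normrE; apply: bigmax_le; first exact: le_trans r1.
  move=> [i j] _; rewrite ord1 /=; apply: le_trans (norm2_coord _ _) _.
  rewrite -ler_sqr ?nnegrE ?sqrtr_ge0 ?(le_trans _ r1)//.
  move: yK; rewrite ler_pdivrMl ?mulr_gt0// => /le_trans; apply.
  by apply: le_trans (ler_eXnr _ r1); rewrite // lerDl.
by rewrite addrC subrK.
Qed.

Let Kx : K x.
Proof.
rewrite /K/= /kinetic subrr norm2_sqr big1 ?mulr0; last first.
  by move=> i _; rewrite mxE expr0n.
by rewrite mulr_ge0 ?addr_ge0 ?ler01//; exact: ltW.
Qed.

Let reduced_costx S : F S x = phi x * S.
Proof.
rewrite /reduced_cost subrr norm2_sqr big1 ?mulr0 ?add0r// => i _.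
by rewrite mxE expr0n.
Qed.

(** Doing better than staying at [x] requires a kinetic energy of at most
    [phi x * S <= M * B]; this confines the search to the compact set [K]. *)
Let minimizer_bounded S y : 0 <= S -> S <= B -> F S y <= F S x -> K y.
Proof.
move=> S0 SB; rewrite reduced_costx => yx.
have yS : 0 <= phi y * S by rewrite mulr_ge0// ltW.
rewrite /K/= (@le_trans _ _ (phi x * S))//.
  by apply: le_trans yx; rewrite lerDl.
by rewrite ler_pM// ltW.
Qed.

Let reduced_minimizer_exists S : 0 <= S -> S <= B ->
  exists y, reduced_minimizer S y.
Proof.
move=> S0 SB.
have cF : continuous (F S).
  move=> y; apply: (@continuousD _ _ _ kinetic (phi \* cst S)).
    exact: kinetic_cont.
  by apply: continuousM; [exact: phi_cont|exact: cst_continuous].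
have K0 : K !=set0 by exists x.
have [y yK ymin] := EVT_min_rV K0 compact_K (continuous_subspaceT cF).
exists y => z; have [zx|xz] := leP (F S z) (F S x).
  by apply: ymin; rewrite inE; exact: minimizer_bounded zx.
by apply: le_trans (ltW xz); apply: ymin; rewrite inE.
Qed.

Let E (P : set (R * 'rV[R]_d)) : set (R * 'rV[R]_d) :=
  (`[0, B]%classic `*` K) `&` ([set p | reduced_minimizer p.1 p.2] `&` P).

Let fst_cont : continuous (fst : R * 'rV[R]_d -> R).
Proof. by move=> p; exact: cvg_fst. Qed.

Let snd_cont : continuous (snd : R * 'rV[R]_d -> 'rV[R]_d).
Proof. by move=> p; exact: cvg_snd. Qed.

Let phi_snd_cont : continuous (fun p : R * 'rV[R]_d => phi p.2).
Proof.
by move=> p; apply: continuous_comp; [exact: snd_cont|exact: phi_cont].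
Qed.

Let closed_minimizers :
  closed [set p : R * 'rV[R]_d | reduced_minimizer p.1 p.2].
Proof.
rewrite (_ : mkset _ = \bigcap_z
  ((fun p : R * 'rV[R]_d => F p.1 p.2 - F p.1 z) @^-1` [set r | r <= 0])).
  apply: closed_bigI => z _.
  apply: ((continuous_closedP _).1 _ _ (@closed_le R 0)) => p.
  apply: (@continuousB _ _ _
    ((kinetic \o snd) \+ ((phi \o snd) \* fst))
    (cst (kinetic z) \+ (cst (phi z) \* fst))).
    apply: continuousD; last first.
      by apply: continuousM; [exact: phi_snd_cont|exact: fst_cont].
    by apply: continuous_comp; [exact: snd_cont|exact: kinetic_cont].
  apply: continuousD; first exact: cst_continuous.
  by apply: continuousM; [exact: cst_continuous|exact: fst_cont].
apply/seteqP; split => p /= H z; first by rewrite /= subr_le0.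
by have := H z I; rewrite /= subr_le0.
Qed.

(** Minimality is a closed condition on [(S, y)], and [y] ranges over a compact
    set: along it, projections are closed. *)
Let closed_projection P : closed P -> closed (fst @` E P).
Proof.
move=> cP; apply: compact_closed; first exact: Rhausdorff.
apply: continuous_compact; first exact: continuous_subspaceT.
apply: compact_closedI; last exact: closedI.
by apply: compact_setX => //; exact: segment_compact.
Qed.

(** The map from [S] to the values of [phi] at minimizers may jump; the two
    minimizers [y1] and [y2] are the two sides of the jump where it crosses the
    diagonal. *)
Lemma reduced_fixed_point : exists S y1 y2,
  [/\ reduced_minimizer S y1, reduced_minimizer S y2 & phi y2 <= S <= phi y1].
Proof.
pose diff (p : R * 'rV[R]_d) := phi p.2 - p.1.
have diff_cont : continuous diff.
  move=> p; apply: (@continuousB _ _ _ (phi \o snd) fst).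
    exact: phi_snd_cont.
  exact: fst_cont.
pose up := fst @` E [set p | p.1 <= phi p.2].
pose dn := fst @` E [set p | phi p.2 <= p.1].
have cup : closed up.
  apply: closed_projection.
  rewrite (_ : mkset _ = diff @^-1` [set r | 0 <= r]).
    exact: ((continuous_closedP diff).1 diff_cont _ (@closed_ge R 0)).
  by apply/seteqP; split => p /=; rewrite /diff subr_ge0.
have cdn : closed dn.
  apply: closed_projection.
  rewrite (_ : mkset _ = diff @^-1` [set r | r <= 0]).
    exact: ((continuous_closedP diff).1 diff_cont _ (@closed_le R 0)).
  by apply/seteqP; split => p /=; rewrite /diff subr_le0.
have cover S : 0 <= S -> S <= B -> up S \/ dn S.
  move=> S0 SB; have [y ymin] := reduced_minimizer_exists S0 SB.
  have Ky : K y by exact: minimizer_bounded (ymin x).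
  have SI : `[0, B]%classic S by rewrite /= in_itv/= S0.
  by have [Sy|/ltW yS] := leP S (phi y); [left|right]; exists (S, y).
have [S [[[S1 y1] [[_ _] [/= min1 le1] /= S1E]]
         [[S2 y2] [[_ _] [/= min2 le2] /= S2E]]]] : exists S, up S /\ dn S.
  apply: contrapT => disj.
  have upE : up = `[0, B]%classic.
    have upI : up `<=` `[0, B]%classic by move=> _ [[S y] [[SI _] _] <-].
    apply: segment_connected.
    - have B0 : 0 <= B by rewrite addr_ge0 ?ler01//; exact: ltW.
      have [y ymin] := reduced_minimizer_exists (lexx 0) B0.
      exists 0, (0, y) => //; split; last by split=> //=; exact: ltW.
      split; first by rewrite /= in_itv/= lexx.
      exact: minimizer_bounded (ymin x).
    - exists (~` dn); first exact: closed_openC.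
      apply/seteqP; split => S /=.
        by move=> uS; split; [exact: upI|move=> dS; apply: disj; exists S].
      by rewrite in_itv/= => -[/andP[S0 SB] ndS]; have [] := cover S S0 SB.
    - by exists up => //; rewrite setIidr.
  have : up B by rewrite upE /= in_itv/= lexx addr_ge0 ?ler01//= ltW.
  move=> [[S y] [_ [_ /= SB]] /= SE].
  by have := le_trans SB (phi_le y); rewrite SE leNgt ltrDl ltr01.
exists S, y1, y2; split; rewrite -?S1E//.
  by rewrite S1E -S2E.
by rewrite le1 andbT S1E -S2E.
Qed.

End fixed_point.

(** * Monotonicity and nonuniqueness *)

Section lasry_lions_product.
Context {R : realType} {d : nat}.
Variable phi : 'rV[R]_d -> R.
Hypotheses (phi_bounded : bounded_fun phi) (phi_cont : continuous phi).
Implicit Types m : probability 'rV[R]_d R.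

Lemma integrable_phi m : m.-integrable setT (EFin \o phi).
Proof.
apply: measurable_bounded_integrable => //.
- by rewrite [X in (X < _)%E]probability_setT ltry.
- exact: continuous_measurable_rV.
Qed.

(** The difference of the couplings is a multiple of [phi] by a constant, whose
    integral against [m1 - m2] produces that constant once more. *)
Lemma integral_diff_product m1 m2 :
  integral_diff m1 m2
    (fun x => phi x * (\int[m1]_y phi y) - phi x * (\int[m2]_y phi y)) =
  ((\int[m1]_y phi y - \int[m2]_y phi y) ^+ 2)%:E.
Proof.
set s1 := \int[m1]_y phi y; set s2 := \int[m2]_y phi y.
have intE m : (\int[m]_x (phi x * s1 - phi x * s2)%:E =
    ((s1 - s2) * \int[m]_x phi x)%:E)%E.
  under eq_integral do rewrite -mulrBr mulrC EFinM.
  rewrite integralZl//; last exact: integrable_phi.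
  rewrite EFinM /Rintegral fineK//.
  by apply: integrable_fin_num => //; exact: integrable_phi.
rewrite /integral_diff !intE -EFinB; congr _%:E.
by rewrite -/s1 -/s2; ring.
Qed.

Lemma strong_lasry_lions_product :
  strong_lasry_lions (fun x m => phi x * \int[m]_y phi y).
Proof.
split=> m1 m2 _ _; rewrite integral_diff_product.
  by rewrite lee_fin sqr_ge0.
move=> [/eqP]; rewrite sqrf_eq0 subr_eq0 => /eqP m12 x.
by rewrite m12.
Qed.

End lasry_lions_product.

Section nonuniqueness.
Context {R : realType} {d : nat} {T : R}.
Variables (phi : 'rV[R]_d -> R) (x : 'rV[R]_d).
Hypotheses (T0 : 0 < T) (phi_gt0 : forall y, 0 < phi y)
  (phi_bounded : bounded_fun phi) (phi_cont : continuous phi).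
Implicit Types (y z : 'rV[R]_d) (S a : R).

(** If both curves of a fixed point that carry some mass stayed at [x], then
    [S] would be [phi x] with [x] a minimizer. *)
Lemma moving_fixed_point :
  ~ reduced_minimizer (T := T) phi x (phi x) x ->
  exists S y1 y2 a,
    [/\ reduced_minimizer (T := T) phi x S y1,
        reduced_minimizer (T := T) phi x S y2, 0 < a <= 1, y1 <> x &
        S = a * phi y1 + (1 - a) * phi y2].
Proof.
move=> xmin.
have [M phi_le] : exists M, forall y, phi y <= M.
  have [N [_ phiN]] := phi_bounded; exists (N + 1) => y.
  by apply: le_trans (ler_norm _) _; apply: phiN => //; rewrite ltrDl.
have [S [y1 [y2 [min1 min2 /andP[S2 S1]]]]] :=
  reduced_fixed_point x T0 phi_gt0 phi_le phi_cont.
have [a a01 SE] : exists2 a, 0 <= a <= 1 & S = a * phi y1 + (1 - a) * phi y2.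
  have [E|/eqP E] := eqVneq (phi y1) (phi y2).
    exists 1; first by rewrite ler01 lexx.
    by rewrite subrr mul0r addr0 mul1r; apply: le_anti; rewrite S1 E S2.
  have D0 : 0 < phi y1 - phi y2.
    by rewrite subr_gt0 lt_neqAle (le_trans S2 S1) andbT eq_sym; apply/eqP.
  exists ((S - phi y2) / (phi y1 - phi y2)).
    apply/andP; split; first by rewrite divr_ge0 ?subr_ge0// (le_trans S2).
    by rewrite ler_pdivrMr// mul1r lerD2r.
  by field; rewrite gt_eqF.
case/andP: a01 => a0 a1.
have [[a00 y1x]|N1] := pselect (0 < a /\ y1 <> x).
  by exists S, y1, y2, a; split => //; rewrite a00.
have [[a11 y2x]|N2] := pselect (a < 1 /\ y2 <> x).
  exists S, y2, y1, (1 - a); split => //; first by rewrite subr_gt0 a11 gerBl.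
  by rewrite SE; ring.
exfalso; apply: xmin.
have [y1x|/eqP y1x] := eqVneq y1 x; have [y2x|/eqP y2x] := eqVneq y2 x.
- suff <- : S = phi x by rewrite -{2}y1x.
  by rewrite SE y1x y2x; ring.
- have aE : a = 1.
    by apply: le_anti; rewrite a1/= leNgt; apply/negP => ?; apply: N2.
  suff <- : S = phi x by rewrite -{2}y1x.
  by rewrite SE aE y1x; ring.
- have aE : a = 0.
    by apply: le_anti; rewrite a0 andbT leNgt; apply/negP => ?; apply: N1.
  suff <- : S = phi x by rewrite -{2}y2x.
  by rewrite SE aE y2x; ring.
- have aE : a = 0.
    by apply: le_anti; rewrite a0 andbT leNgt; apply/negP => ?; apply: N1.
  by exfalso; apply: N2; rewrite aE ltr01.
Qed.

Lemma reduced_minimizer_reflect S y :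
  (forall z, phi (x + z) = phi (x - z)) ->
  reduced_minimizer (T := T) phi x S y ->
  reduced_minimizer (T := T) phi x S (x + (x - y)).
Proof.
move=> phi_sym ymin z; apply: le_trans (ymin z).
rewrite /reduced_cost phi_sym opprB addrC [x + (y - x)]addrC subrK addrC.
rewrite [x + (x - y)]addrC addrK -opprB !norm2_sqr lerD2r ler_wpM2l//.
  by rewrite invr_ge0 mulr_ge0// ltW.
by apply: ler_sum => i _; rewrite [X in X ^+ 2]mxE sqrrN.
Qed.

Lemma equilibrium_of_fixed_point S y1 y2 a
    (eta : probability (curve R d T) R) :
  two_point_law a (straight T0 x y1) (straight T0 x y2) eta -> 0 <= a <= 1 ->
  S = a * phi y1 + (1 - a) * phi y2 ->
  reduced_minimizer (T := T) phi x S y1 ->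
  reduced_minimizer (T := T) phi x S y2 ->
  equilibrium (fun _ v => 2^-1 * norm2 v ^+ 2)
    (fun z m => phi z * \int[m]_y phi y) \d_x eta.
Proof.
move=> etaE a01 SE min1 min2.
have sigmaE : \int[distribution eta (ev T)]_y phi y = S.
  have lawE : two_point_law a y1 y2 (distribution eta (ev T)).
    move=> A mA; transitivity (eta (ev T @^-1` A)); first by [].
    rewrite etaE; last first.
      by rewrite -[_ @^-1` _]setTI; exact: measurable_ev.
    have memE y : (straight T0 x y \in ev T @^-1` A) = (y \in A).
      by rewrite -[in RHS](straight_funT x y T0); apply/idP/idP; rewrite !inE.
    by rewrite !diracE !memE.
  rewrite (Rintegral_two_point lawE a01) ?SE//.
    exact: continuous_measurable_rV.
  by move=> y; exact: ltW.
by apply: (two_point_equilibrium etaE);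
  apply: (@straight_minimizer _ _ _ T0 phi (fun m => \int[m]_y phi y));
  rewrite sigmaE.
Qed.

End nonuniqueness.

Theorem proposition3p5 (R : realType) (d : nat) (phi : 'rV[R]_d -> R)
    (x0 : 'rV[R]_d)
    (phi_gt0 : forall x, 0 < phi x)
    (phi_bounded : bounded_fun phi)
    (phi_continuous : continuous phi)
    (phi_sym : forall y, phi (x0 + y) = phi (x0 - y))
    (phi_lt : exists z, phi (x0 + z) < phi x0) :
  let sigmaT := fun m : probability 'rV[R]_d R => \int[m]_x phi x in
  let G := fun (x : 'rV[R]_d) (m : probability 'rV[R]_d R) =>
    phi x * sigmaT m in
  let L := fun x v : 'rV[R]_d => 2^-1 * norm2 v ^+ 2 in
  strong_lasry_lions G /\
  exists2 T : R, 0 < T &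
    exists eta1 eta2 : probability (curve R d T) R,
      [/\ equilibrium L G (\d_x0) eta1,
          equilibrium L G (\d_x0) eta2 &
          exists2 A, measurable A & eta1 A <> eta2 A].
Proof.
move=> sigmaT G L; split; first exact: strong_lasry_lions_product.
have [z phiz] := phi_lt.
(* what moving to [x0 + z] saves when everybody stays at [x0]; [T] is chosen
   so that the move costs less than half of it *)
pose gain := phi x0 * (phi x0 - phi (x0 + z)).
have gain_gt0 : 0 < gain by rewrite mulr_gt0// subr_gt0.
have [T T0 TE] : exists2 T, 0 < T & T * gain = norm2 z ^+ 2 + 1.
  exists ((norm2 z ^+ 2 + 1) / gain); last by rewrite divfK// gt_eqF.
  by rewrite divr_gt0// ltr_wpDl// sqr_ge0.
exists T => //.
have stay : ~ reduced_minimizer (T := T) phi x0 (phi x0) x0.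
  move=> /(_ (x0 + z)); rewrite /reduced_cost subrr (addrC x0 z) addrK.
  have -> : norm2 (0 : 'rV[R]_d) ^+ 2 = 0.
    by rewrite norm2_sqr big1// => i _; rewrite mxE expr0n.
  rewrite mulr0 add0r (addrC z x0) -lerBlDr.
  have -> : phi x0 * phi x0 - phi (x0 + z) * phi x0 = gain.
    by rewrite /gain; ring.
  rewrite ler_pdivlMl ?mulr_gt0// -mulrA TE.
  by have := sqr_ge0 (norm2 z); lra.
have [S [y1 [y2 [a [min1 min2 /andP[a0 a1] y1x SE]]]]] :=
  moving_fixed_point T0 phi_gt0 phi_bounded phi_continuous stay.
have a01 : 0 <= a <= 1 by rewrite (ltW a0).
pose y1' := x0 + (x0 - y1).
have min1' : reduced_minimizer (T := T) phi x0 S y1'.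
  exact: reduced_minimizer_reflect.
have phiy1' : phi y1' = phi y1.
  by rewrite /y1' phi_sym opprB addrC subrK.
have y1'y1 : y1' <> y1.
  rewrite /y1' => y1E; apply: y1x.
  have : 2 *: (x0 - y1) = 0 by rewrite scaler_nat mulr2n addrAC y1E subrr.
  by move/eqP; rewrite scaler_eq0 pnatr_eq0/= subr_eq0 => /eqP.
have [eta1 eta1E] := two_point_law_exists (R := R) (straight T0 x0 y1)
  (straight T0 x0 y2) a01.
have [eta2 eta2E] := two_point_law_exists (R := R) (straight T0 x0 y1')
  (straight T0 x0 y2) a01.
exists eta1, eta2; split.
- exact: (equilibrium_of_fixed_point phi_gt0 phi_continuous eta1E a01 SE).
- have SE' : S = a * phi y1' + (1 - a) * phi y2 by rewrite phiy1'.
  exact: (equilibrium_of_fixed_point phi_gt0 phi_continuous eta2E a01 SE').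
have mA : measurable (ev T @^-1` [set y1] : set (curve R d T)).
  rewrite -[_ @^-1` _]setTI; apply: measurable_ev => //.
  exact: measurable_rV_set1.
(* the reflected law loses the mass [a] of the curve that ends at [y1] *)
exists (ev T @^-1` [set y1]) => //.
rewrite eta1E// eta2E// !diracE.
have -> : straight T0 x0 y1 \in ev T @^-1` [set y1].
  by rewrite inE; exact: straight_funT.
have -> : (straight T0 x0 y1' \in ev T @^-1` [set y1]) = false.
  apply: memNset => y1E; apply: y1'y1.
  by rewrite -[LHS](straight_funT x0 y1' T0); exact: y1E.
rewrite mule0 add0e mule1.
move: (_ \in _) => b; rewrite -EFinM -EFinD => -[/eqP].
by rewrite eq_sym addrC -subr_eq subrr => /eqP a00; rewrite -a00 ltxx in a0.
Qed.
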